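(* For any two non-empty finite sets of primes $P_1$ and $P_2$, there exists a network $\mathcal{N}$ such that $P(\mathcal{N},1)=P_1$ and $P(\mathcal{N},2)=P_1\cup P_2$.
   Context: A network is a finite directed acyclic multigraph whose nodes are partitioned into sources (no incoming edges), terminals (no outgoing edges) and intermediate nodes; each terminal demands the messages of a specified set of sources. For a positive integer $d$ and a finite field $F$, a $d$-dimensional vector linear network code (VLNC) over $F$ works as follows: each source $s$ generates a message $x_s\in F^d$ (messages of different sources are independent and arbitrary); each edge $e$ carries a vector $y_e\in F^d$, where $y_e=Ax_s$ for some $d\times d$ matrix $A$ over $F$ if the tail of $e$ is a source $s$, and $y_e=\sum_{e'} A_{e',e}y_{e'}$ (sum over edges $e'$ entering the tail of $e$, with $d\times d$ matrices $A_{e',e}$ over $F$) if the tail of $e$ is an intermediate node; each terminal $t$ computes vectors of the form $\sum_{e} B_e y_e$ (sum over edges $e$ entering $t$, with fixed $d\times d$ matrices $B_e$). The code is a $d$-dimensional VLNC solution over $F$ if for all choices of source messages every terminal computes each of its demanded messages. A $1$-dimensional VLNC solution is a scalar linear network coding (SLNC) solution. For a network $\mathcal{N}$, a positive integer $d$ and a set $S$ of primes, we write $P(\mathcal{N},d)=S$ to mean: for every finite field $F$, $\mathcal{N}$ has a $d$-dimensional VLNC solution over $F$ if and only if the characteristic of $F$ belongs to $S$. *)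

(* Defs.v *)
From HB Require Import structures.
From mathcomp Require Import all_boot all_order all_algebra all_field.
Set Implicit Arguments. Unset Strict Implicit. Unset Printing Implicit Defensive.
Import GRing.Theory.
Local Open Scope ring_scope.

Inductive node_kind := Source | Intermediate | Terminal.

(* A network: nodes 'I_nnodes, edges 'I_nedges (multigraph: several edges
   may share tail and head).  Acyclicity is encoded by a topological
   numbering of the nodes: every edge goes from a smaller to a larger node
   (any finite DAG admits such a numbering).  Sources have no incoming edges,
   terminals have no outgoing edges; demand t s means terminal t demands the
   message of source s. *)
Record network := Network {
  nnodes : nat;
  nedges : nat;
  tail : 'I_nedges -> 'I_nnodes;
  head : 'I_nedges -> 'I_nnodes;
  kind : 'I_nnodes -> node_kind;
  demand : 'I_nnodes -> 'I_nnodes -> bool;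
  tail_lt_head : forall e, (tail e < head e)%N;
  source_no_in : forall e, kind (head e) <> Source;
  terminal_no_out : forall e, kind (tail e) <> Terminal;
  demand_ok : forall t s, demand t s -> kind t = Terminal /\ kind s = Source
}.

Definition edge_consistent (N : network) (F : fieldType) (d : nat)
  (Asrc : 'I_(nedges N) -> 'M[F]_d)
  (Aint : 'I_(nedges N) -> 'I_(nedges N) -> 'M[F]_d)
  (x : 'I_(nnodes N) -> 'cV[F]_d) (y : 'I_(nedges N) -> 'cV[F]_d) : Prop :=
  forall e : 'I_(nedges N),
    (kind (tail e) = Source -> y e = Asrc e *m x (tail e)) /\
    (kind (tail e) = Intermediate ->
       y e = \sum_(e' < nedges N | head e' == tail e) Aint e' e *m y e').

(* N has a d-dimensional vector linear network code solution over F.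
   Since N is acyclic, for every x there is exactly one consistent y. *)
Definition vlnc_solution (N : network) (d : nat) (F : fieldType) : Prop :=
  exists (Asrc : 'I_(nedges N) -> 'M[F]_d)
         (Aint : 'I_(nedges N) -> 'I_(nedges N) -> 'M[F]_d)
         (B : 'I_(nnodes N) -> 'I_(nnodes N) -> 'I_(nedges N) -> 'M[F]_d),
    forall (x : 'I_(nnodes N) -> 'cV[F]_d) (y : 'I_(nedges N) -> 'cV[F]_d),
      edge_consistent Asrc Aint x y ->
      forall t s, @demand N t s ->
        \sum_(e < nedges N | head e == t) B t s e *m y e = x s.

Definition P_eq (N : network) (d : nat) (S : seq nat) : Prop :=
  forall F : finFieldType,
    vlnc_solution N d F <-> has (fun p => p \in [pchar F]) S.

(* Main.v *)
Require Import Defs.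
From HB Require Import structures.
From mathcomp Require Import all_boot all_order all_algebra all_field.
From mathcomp Require Import ring.
Set Implicit Arguments. Unset Strict Implicit. Unset Printing Implicit Defensive.
Import GRing.Theory.
Local Open Scope ring_scope.

(** The characteristic enters through a Fano-like network.  From sources y, z,
    x_0, ..., x_m form u = y + z + sum_i x_i and h_i = z + x_i; demanding y from
    u, h_i and the x_l with l != i makes these forms the only possible ones, up
    to an invertible factor and a change of basis of the messages.  A bottleneck
    g_k fed by the h_i with i < k, from which together with u, z and the x_l
    with l >= k one must recover y, then carries k z + x_0 + ... + x_(k-1).
    Hence x_0 can be recovered from g_k and the x_l with l > 0 exactly when
    k = 0 in F, whatever the dimension; this is demanded for k = prod P1 * prod P2.

    For k = prod P1 the terminal that demands x_0 may also cancel z, thanks to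
    a variant of the M-network: e_0 mixes a and z, e_1 mixes r_0 and r_1, and
    for each pair (i, j) a terminal sees e_0, e_1 and one free edge and
    must recover the i-th of (a, z) and the j-th of (r_0, r_1).  Putting half of
    each message on e_0 and e_1 solves it in dimension 2.  In dimension 1 each
    terminal leaves room for one interfering symbol only, and the four terminals
    are incompatible; so z cannot be cancelled at (1, 1), and k = 0 in F. *)

(** * Digraphs with arbitrary finite vertex types *)

(** Arcs are a relation on an arbitrary finite type, so constructions need no numbering. [rk] may
    have ties; sorting by it yields a topological numbering. *)
Record digraph := Digraph {
  vertex : finType;
  adj : rel vertex;
  rk : vertex -> nat;
  vkind : vertex -> node_kind;
  wants : rel vertex;
  adj_rk : forall u v, adj u v -> (rk u < rk v)%N;
  adj_not_source : forall u v, adj u v -> vkind v <> Source;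
  adj_not_terminal : forall u v, adj u v -> vkind u <> Terminal;
  wants_kind : forall t s, wants t s -> vkind t = Terminal /\ vkind s = Source
}.

Definition digraph_solution (G : digraph) (d : nat) (F : fieldType) : Prop :=
  exists (Asrc : vertex G -> vertex G -> 'M[F]_d)
         (Aint : vertex G -> vertex G -> vertex G -> 'M[F]_d)
         (B : vertex G -> vertex G -> vertex G -> 'M[F]_d),
    forall (x : vertex G -> 'cV[F]_d) (y : vertex G -> vertex G -> 'cV[F]_d),
      (forall v w, adj v w ->
         (vkind v = Source -> y v w = Asrc v w *m x v) /\
         (vkind v = Intermediate ->
            y v w = \sum_(u | adj u v) Aint u v w *m y u v)) ->
      forall t s, wants t s -> \sum_(u | adj u t) B t s u *m y u t = x s.

(** * Numbering the vertices and arcs of a digraph *)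

Section ToNetwork.

Variable G : digraph.

Definition vertices : seq (vertex G) :=
  sort (fun u v => rk u <= rk v)%N (enum (vertex G)).
Definition arcs : seq (vertex G * vertex G) :=
  enum (fun e : vertex G * vertex G => adj e.1 e.2).

Lemma mem_vertices v : v \in vertices.
Proof. by rewrite mem_sort mem_enum. Qed.

Lemma index_vertices_lt v : (index v vertices < size vertices)%N.
Proof. by rewrite index_mem mem_vertices. Qed.

Definition vidx v : 'I_(size vertices) := Ordinal (index_vertices_lt v).
Definition vtx (i : 'I_(size vertices)) : vertex G := tnth (in_tuple vertices) i.
Definition arc (i : 'I_(size arcs)) : vertex G * vertex G := tnth (in_tuple arcs) i.

Lemma vidxK : cancel vidx vtx.
Proof. by move=> v; rewrite /vtx (tnth_nth v) /= nth_index // mem_vertices. Qed.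

Lemma vtxK : cancel vtx vidx.
Proof.
move=> i; apply: val_inj => /=; rewrite /vtx (tnth_nth (vtx i)) /=.
by rewrite index_uniq // sort_uniq enum_uniq.
Qed.

Lemma arcP i : adj (arc i).1 (arc i).2.
Proof. by have := mem_tnth i (in_tuple arcs); rewrite mem_enum. Qed.

Lemma vidx_lt u v : (rk u < rk v)%N -> (vidx u < vidx v)%N.
Proof.
move=> ltuv; rewrite ltnNge; apply: contraL ltuv => levu; rewrite -leqNgt.
have tot : total (fun u v : vertex G => rk u <= rk v)%N by move=> ? ?; exact: leq_total.
have := sorted_leq_nth _ _ u (sort_sorted tot (enum (vertex G))).
move=> /(_ (fun _ _ _ => @leq_trans _ _ _) (fun _ => leqnn _)).
move=> /(_ (vidx v) (vidx u)); rewrite !inE !ltn_ord => /(_ isT isT levu).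
by rewrite !nth_index ?mem_vertices.
Qed.

Definition arc_tail i := vidx (arc i).1.
Definition arc_head i := vidx (arc i).2.

Lemma arc_tail_lt_head i : (arc_tail i < arc_head i)%N.
Proof. exact/vidx_lt/adj_rk/arcP. Qed.

Lemma arc_head_kind i : vkind (vtx (arc_head i)) <> Source.
Proof. by rewrite vidxK; exact: adj_not_source (arcP i). Qed.

Lemma arc_tail_kind i : vkind (vtx (arc_tail i)) <> Terminal.
Proof. by rewrite vidxK; exact: adj_not_terminal (arcP i). Qed.

Definition network_of : network :=
  @Network (size vertices) (size arcs) arc_tail arc_head
    (fun i => vkind (vtx i)) (fun i j => wants (vtx i) (vtx j))
    arc_tail_lt_head arc_head_kind arc_tail_kind
    (fun i j => @wants_kind G (vtx i) (vtx j)).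

(** Codes are indexed by arc numbers in a network and by pairs of vertices in a digraph; this passes
    from the former to the latter, with default [x0] on pairs that are not arcs. *)
Definition extend_arc T (x0 : T) (f : 'I_(size arcs) -> T) u v : T :=
  oapp f x0 (insub (index (u, v) arcs)).

Lemma extend_arcE T (x0 : T) f i : extend_arc x0 f (arc i).1 (arc i).2 = f i.
Proof.
rewrite /extend_arc -surjective_pairing /arc (tnth_nth (arc i)) /=.
by rewrite index_uniq ?enum_uniq // valK.
Qed.

Lemma adj_arc u v : adj u v -> exists i, arc i = (u, v).
Proof.
move=> uv; have uvin : (u, v) \in arcs by rewrite mem_enum.
have lti : (index (u, v) arcs < size arcs)%N by rewrite index_mem.
by exists (Ordinal lti); rewrite /arc (tnth_nth (u, v)) /= nth_index.
Qed.

Lemma sum_arc_head (M : nmodType) (f : vertex G -> M) v :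
  \sum_(i < size arcs | (arc i).2 == v) f (arc i).1 = \sum_(u | adj u v) f u.
Proof.
transitivity (\sum_(e <- arcs | e.2 == v) f e.1).
  by rewrite [RHS]big_tnth.
rewrite big_enum_cond /=.
rewrite -(pair_big_dep xpredT (fun u w => adj u w && (w == v)) (fun u _ => f u)) /=.
rewrite [RHS]big_mkcond; apply: eq_bigr => u _.
rewrite big_mkcond (bigD1 v) //= eqxx andbT big1 ?addr0 // => w /negPf ->.
by rewrite andbF.
Qed.

Lemma network_of_solution d (F : fieldType) :
  vlnc_solution network_of d F <-> digraph_solution G d F.
Proof.
split=> [[As [Ai [B sol]]]|[As [Ai [B sol]]]].
  exists (extend_arc 0 As).
  exists (fun u v w => extend_arc 0 (fun i => extend_arc 0 (Ai i) v w) u v).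
  exists (fun t s u => extend_arc 0 (B (vidx t) (vidx s)) u t).
  move=> x y ycons t s ts.
  pose x' i := x (vtx i); pose y' i := y (arc i).1 (arc i).2.
  have := sol x' y' _ (vidx t) (vidx s).
  rewrite /x' /= !vidxK => <- //; last first.
    move=> e /=; rewrite vidxK /y'; have [srcE intE] := ycons _ _ (arcP e).
    split=> [/srcE->|/intE->]; first by rewrite extend_arcE.
    rewrite -sum_arc_head; apply: eq_big => [i|i /eqP he].
      by rewrite (can_eq vidxK).
    by rewrite -he extend_arcE he extend_arcE.
  rewrite -sum_arc_head; apply: eq_big => [i|i /eqP he].
    by rewrite /= (can_eq vidxK).
  by rewrite -he extend_arcE.
exists (fun i => As (arc i).1 (arc i).2).
exists (fun i j => Ai (arc i).1 (arc i).2 (arc j).2).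
exists (fun t s i => B (vtx t) (vtx s) (arc i).1).
move=> x y ycons t s ts.
pose x' v := x (vidx v); pose y' u v := extend_arc 0 y u v.
have := sol x' y' _ (vtx t) (vtx s) ts.
rewrite /x' vtxK => <-; last first.
  move=> v w /adj_arc[i]; have := ycons i; rewrite /= vidxK.
  move: (extend_arcE 0 y i) => + + iE; rewrite -/(y' _ _) iE /= => -> [srcE intE].
  split=> [/srcE->|/intE->]; first by rewrite /arc_tail iE.
  rewrite -sum_arc_head; apply: eq_big => [j|j /eqP he] /=.
    by rewrite /arc_tail /arc_head iE (can_eq vidxK).
  have {}he : (arc j).2 = v by rewrite -[RHS]/(v, w).1 -iE; exact: (can_inj vidxK).
  by rewrite -he /y' extend_arcE.
rewrite -sum_arc_head; apply: eq_big => [j|j /eqP he] /=.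
  by rewrite /arc_head -(can_eq vtxK) vidxK.
by rewrite -he /= /arc_head vidxK /y' extend_arcE.
Qed.

End ToNetwork.

(** * Networks of bottlenecks *)

(* A point is a bottleneck: it forwards to all its consumers the same
   combination of the sources [psrc p] and of the points [ppnt p]; the terminal
   [t] sees the sources [tsrc t] and the points [tpnt t] and demands [goal t]. *)
Record circuit := Circuit {
  src : finType;
  pnt : finType;
  trm : finType;
  psrc : pnt -> pred src;
  ppnt : pnt -> seq pnt;
  tsrc : trm -> pred src;
  tpnt : trm -> seq pnt;
  goal : trm -> src;
  lvl : pnt -> nat;
  ppnt_uniq : forall p, uniq (ppnt p);
  tpnt_uniq : forall t, uniq (tpnt t);
  ppnt_lvl : forall p q, q \in ppnt p -> (lvl q < lvl p)%N
}.

(* [M p s] is the matrix through which the message of source [s] reaches the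
   point [p]; a source directly available to [p] or [t] can be combined
   freely, so it imposes no condition. *)
Definition transfer_matrices (C : circuit) (d : nat) (F : fieldType)
    (M : pnt C -> src C -> 'M[F]_d) : Prop :=
  (forall p, exists A : pnt C -> 'M[F]_d, forall s, ~~ psrc p s ->
     M p s = \sum_(q <- ppnt p) A q *m M q s) /\
  (forall t, exists B : pnt C -> 'M[F]_d, forall s, ~~ tsrc t s ->
     \sum_(q <- tpnt t) B q *m M q s = if s == goal t then 1%:M else 0).

Definition circuit_solution (C : circuit) (d : nat) (F : fieldType) : Prop :=
  exists M : pnt C -> src C -> 'M[F]_d, transfer_matrices M.

(** * Circuits as digraphs *)

Section CircuitGraph.

Variable C : circuit.

Let V : finType := (src C + (pnt C + pnt C) + trm C)%type.

Definition cadj : rel V := fun u v =>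
  match u, v with
  | inl (inl s), inl (inr (inl p)) => psrc p s
  | inl (inl s), inr t => tsrc t s
  | inl (inr (inl p)), inl (inr (inr q)) => p == q
  | inl (inr (inr q)), inl (inr (inl p)) => q \in ppnt p
  | inl (inr (inr q)), inr t => q \in tpnt t
  | _, _ => false
  end.

Definition crk (u : V) : nat :=
  match u with
  | inl (inl _) => 0
  | inl (inr (inl p)) => (lvl p).*2.+1
  | inl (inr (inr p)) => (lvl p).*2.+2
  | inr _ => (\max_(p : pnt C) lvl p).*2.+3
  end.

Definition ckind (u : V) : node_kind :=
  match u with
  | inl (inl _) => Source
  | inr _ => Terminal
  | _ => Intermediate
  end.

Definition cwants : rel V := fun t s =>
  match t, s with
  | inr t, inl (inl s) => s == goal t
  | _, _ => false
  end.

Lemma cadj_crk u v : cadj u v -> (crk u < crk v)%N.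
Proof.
case: u => [[s|[p|p]]|t]; case: v => [[s'|[q|q]]|t'] //=.
- by move/eqP->.
- by move=> /ppnt_lvl; rewrite !ltnS ltn_Sdouble.
- by move=> _; rewrite !ltnS leq_double; exact: leq_bigmax.
Qed.

Lemma cadj_not_source u v : cadj u v -> ckind v <> Source.
Proof. by case: u => [[s|[p|p]]|t]; case: v => [[s'|[q|q]]|t']. Qed.

Lemma cadj_not_terminal u v : cadj u v -> ckind u <> Terminal.
Proof. by case: u => [[s|[p|p]]|t]; case: v => [[s'|[q|q]]|t']. Qed.

Lemma cwants_kind t s : cwants t s -> ckind t = Terminal /\ ckind s = Source.
Proof. by case: t => [[s'|[p|p]]|t]; case: s => [[s|[q|q]]|t']. Qed.

(* A point is an arc from its entrance [inl (inr (inl p))] to its exit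
   [inl (inr (inr p))]. *)
Definition circuit_graph : digraph :=
  Digraph cadj_crk cadj_not_source cadj_not_terminal cwants_kind.

Lemma sum_cadj_in (M : nmodType) (f : V -> M) p :
  \sum_(u | cadj u (inl (inr (inl p)))) f u
    = \sum_(s | psrc p s) f (inl (inl s)) + \sum_(q <- ppnt p) f (inl (inr (inr q))).
Proof.
rewrite !big_sumType /= (big_uniq _ (ppnt_uniq p)) /= !big_pred0_eq.
by rewrite !addr0 add0r.
Qed.

Lemma sum_cadj_out (M : nmodType) (f : V -> M) p :
  \sum_(u | cadj u (inl (inr (inr p)))) f u = f (inl (inr (inl p))).
Proof. by rewrite !big_sumType /= big_pred1_eq !big_pred0_eq !addr0 add0r. Qed.

Lemma sum_cadj_trm (M : nmodType) (f : V -> M) t :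
  \sum_(u | cadj u (inr t)) f u
    = \sum_(s | tsrc t s) f (inl (inl s)) + \sum_(q <- tpnt t) f (inl (inr (inr q))).
Proof.
rewrite !big_sumType /= (big_uniq _ (tpnt_uniq t)) /= !big_pred0_eq.
by rewrite !addr0 add0r.
Qed.

End CircuitGraph.

Lemma mulmx_colP (F : fieldType) (d : nat) (A B : 'M[F]_d) :
  (forall v : 'cV[F]_d, A *m v = B *m v) -> A = B.
Proof.
move=> eqAB; apply/matrixP => i j; have := eqAB (delta_mx j 0).
by rewrite -!colE => /matrixP/(_ i 0); rewrite !mxE.
Qed.

(** * Codes on a circuit and their transfer matrices *)

Section CircuitSolution.

Variables (C : circuit) (d : nat) (F : fieldType).

(** The recursion along [ppnt] is well founded by [lvl]: iterating [step] from 0, the value at [p]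
    is stable after [(lvl p).+1] rounds. *)
Lemma response_exists (As : pnt C -> src C -> 'M[F]_d)
    (A : pnt C -> pnt C -> 'M[F]_d) :
  exists M : pnt C -> src C -> 'M[F]_d, forall p s,
    M p s = (if psrc p s then As p s else 0) + \sum_(q <- ppnt p) A p q *m M q s.
Proof.
pose step (M : pnt C -> src C -> 'M[F]_d) p s :=
  (if psrc p s then As p s else 0) + \sum_(q <- ppnt p) A p q *m M q s.
pose it k := iter k step (fun _ _ => 0).
have stable k k' p s : (lvl p < k)%N -> (lvl p < k')%N -> it k p s = it k' p s.
  elim: k k' p => [|k IH] [|k'] p //= ltk ltk'.
  congr (_ + _); rewrite !big_seq; apply: eq_bigr => q /ppnt_lvl qp.
  by rewrite (IH k') // (leq_trans qp).
exists (fun p s => it (lvl p).+1 p s) => p s.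
rewrite [LHS]/=; congr (_ + _); rewrite !big_seq; apply: eq_bigr => q /ppnt_lvl qp.
by rewrite -/(it _) (stable _ (lvl q).+1).
Qed.

(** From a code, [M] is its response, and the terminal conditions come from messages that vanish at
    all sources but one. Conversely, a source seen directly supplies whatever its prescribed
    coefficient lacks, so only the unseen sources impose conditions. *)
Lemma circuit_graph_solution :
  digraph_solution (circuit_graph C) d F <-> circuit_solution C d F.
Proof.
split=> [[As [Ai [B sol]]]|[M [Mpnt Mtrm]]].
  (* [M p s] will describe the arc from the entrance to the exit of [p], so each weight composes the
     matrices met on the way to that arc. *)
  pose Asp p s := Ai (inl (inl s)) (inl (inr (inl p))) (inl (inr (inr p)))
    *m As (inl (inl s)) (inl (inr (inl p))).
  pose App p q := Ai (inl (inr (inr q))) (inl (inr (inl p))) (inl (inr (inr p)))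
    *m Ai (inl (inr (inl q))) (inl (inr (inr q))) (inl (inr (inl p))).
  have [M ME] := response_exists Asp App.
  exists M; split=> [p|t].
    by exists (App p) => s /negPf nps; rewrite ME nps add0r.
  pose Bt q := B (inr t) (inl (inl (goal t))) (inl (inr (inr q)))
    *m Ai (inl (inr (inl q))) (inl (inr (inr q))) (inr t).
  exists Bt => s /negPf nts; apply: mulmx_colP => v.
  pose x (u : vertex (circuit_graph C)) :=
    if u is inl (inl s') then if s' == s then v else 0 else 0.
  pose y (u w : vertex (circuit_graph C)) := match u, w with
    | inl (inl s), _ => As u w *m x u
    | inl (inr (inl p)), _ => M p s *m v
    | inl (inr (inr p)), _ => Ai (inl (inr (inl p))) u w *m (M p s *m v)
    | _, _ => 0 end.
  have := sol x y _ (inr t) (inl (inl (goal t))) (eqxx _).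
  rewrite /= sum_cadj_trm big1 ?add0r => [eqt|s' ts']; last first.
    rewrite /x /=; have [e|_] := eqVneq s' s; last by rewrite !mulmx0.
    by rewrite e nts in ts'.
  rewrite mulmx_suml; under eq_bigr do rewrite -!mulmxA; rewrite eqt.
    by rewrite /x eq_sym; case: ifP => _; rewrite ?mul1mx ?mul0mx.
  move=> {eqt}; move=> u w; case: u => [[s'|[p|p]]|t']; case: w => [[s''|[q|q]]|t''] //=;
    try by move=> _; split=> // _; rewrite sum_cadj_out.
  move=> /eqP <-; split=> // _; rewrite sum_cadj_in /= ME mulmxDl mulmx_suml; congr (_ + _).
    rewrite big_mkcond (bigD1 s) //= big1 ?addr0 => [|s' nes].
      by case: ifP => _; rewrite ?mul0mx // /x eqxx /Asp mulmxA.
    by rewrite /x (negPf nes) !mulmx0 if_same.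
  by apply: eq_bigr => q' _; rewrite /App !mulmxA.
have /fin_all_exists[A AE] := Mpnt; have /fin_all_exists[B BE] := Mtrm.
(* The part of the prescribed coefficient that the points do not deliver; the direct link from [s]
   adds it. *)
pose As p s := M p s - \sum_(q <- ppnt p) A p q *m M q s.
pose Bs t s := (if s == goal t then 1%:M else 0) - \sum_(q <- tpnt t) B t q *m M q s.
exists (fun _ _ => 1%:M).
exists (fun u v w => match u, v with
  | inl (inl s), inl (inr (inl p)) => As p s
  | inl (inr (inr q)), inl (inr (inl p)) => A p q
  | _, _ => 1%:M end).
exists (fun v _ u => match u, v with
  | inl (inl s), inr t => Bs t s
  | inl (inr (inr q)), inr t => B t q
  | _, _ => 1%:M end).
move=> x y ycons [//|t] [[s|//]|//] /= /eqP ->.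
pose z p := y (inl (inr (inl p))) (inl (inr (inr p))).
have ysrc s' w : cadj (inl (inl s')) w -> y (inl (inl s')) w = x (inl (inl s')).
  by move=> /ycons[/(_ erefl) -> _]; rewrite mul1mx.
have yout p w : cadj (inl (inr (inr p))) w -> y (inl (inr (inr p))) w = z p.
  by move=> /ycons[_ /(_ erefl) ->]; rewrite sum_cadj_out mul1mx.
have zE p : z p = \sum_s M p s *m x (inl (inl s)).
  have [k] := ubnP (lvl p); elim: k p => // k IH p ltk.
  rewrite /z; have [_ /(_ erefl) ->] := ycons (inl (inr (inl p))) (inl (inr (inr p))) (eqxx _).
  rewrite sum_cadj_in /=.
  under eq_bigr => s' ps' do rewrite ysrc // mulmxBl mulmx_suml.
  rewrite big_seq; under [X in _ + X]eq_bigr => q qp.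
    rewrite yout // IH ?mulmx_sumr; last by rewrite (leq_trans (ppnt_lvl qp)).
    over.
  rewrite -big_seq exchange_big /= big_mkcond -big_split /=; apply: eq_bigr => s' _.
  case: ifP => [_|/negbT/AE->].
    by under [X in _ + X = _]eq_bigr do rewrite mulmxA; rewrite subrK.
  by rewrite add0r mulmx_suml; under eq_bigr do rewrite mulmxA.
rewrite sum_cadj_trm.
under eq_bigr => s' ps' do rewrite ysrc // mulmxBl mulmx_suml.
rewrite big_seq; under [X in _ + X]eq_bigr => q qt do rewrite yout // zE mulmx_sumr.
rewrite -big_seq exchange_big /= big_mkcond -big_split /=.
rewrite (bigD1 (goal t)) //= [X in _ + X = _]big1 ?addr0 => [|s' /negPf ns].
  case: ifPn => [_|/BE].
    under [X in _ + X = _]eq_bigr do rewrite mulmxA.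
    by rewrite subrK eqxx mul1mx.
  rewrite eqxx => BEt; under eq_bigr do rewrite mulmxA.
  by rewrite -mulmx_suml BEt mul1mx add0r.
case: ifPn => [_|/BE]; under [X in _ + X = _]eq_bigr do rewrite mulmxA.
  by rewrite subrK ns mul0mx.
by rewrite -mulmx_suml ns => ->; rewrite mul0mx add0r.
Qed.

End CircuitSolution.

Definition circuit_network (C : circuit) : network := network_of (circuit_graph C).

Lemma circuit_networkP (C : circuit) d F :
  vlnc_solution (circuit_network C) d F <-> circuit_solution C d F.
Proof.
exact: iff_trans (network_of_solution _ _ _) (circuit_graph_solution _ _ _).
Qed.

(** * The network separating dimensions 1 and 2 *)

Inductive source m := SY | SZ | SX of 'I_m.+1 | SA | SR of bool.
(* [PE false] and [PE true] are the edges e_0 and e_1; [PM i j] is the free edge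
   of the terminals [TL i j] and [TR i j], which demand the left and the right
   message of the pair (i, j).  [TL true true] demands x_0 in place of z. *)
Inductive point m := PU | PH of 'I_m.+1 | PG of bool | PE of bool | PM of bool & bool.
Inductive terminal m :=
  TX of 'I_m.+1 | TZ | TH of 'I_m.+1 | TG of bool | TK | TL of bool & bool | TR of bool & bool.

Arguments SY {m}. Arguments SZ {m}. Arguments SA {m}. Arguments SR {m}.
Arguments PU {m}. Arguments PG {m}. Arguments PE {m}. Arguments PM {m}.
Arguments TZ {m}. Arguments TG {m}. Arguments TK {m}. Arguments TL {m}. Arguments TR {m}.

Section Encoding.
Variable m : nat.

Definition source_code (s : source m) : option (option (option ('I_m.+1 + bool))) :=
  match s with
  | SY => None
  | SZ => Some None
  | SA => Some (Some None)
  | SX i => Some (Some (Some (inl i)))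
  | SR b => Some (Some (Some (inr b)))
  end.
Definition source_decode c : source m :=
  match c with
  | None => SY
  | Some None => SZ
  | Some (Some None) => SA
  | Some (Some (Some (inl i))) => SX i
  | Some (Some (Some (inr b))) => SR b
  end.
Lemma source_codeK : cancel source_code source_decode. Proof. by case. Qed.

Definition point_code (p : point m) : option ('I_m.+1 + (bool + bool) + bool * bool) :=
  match p with
  | PU => None
  | PH i => Some (inl (inl i))
  | PG b => Some (inl (inr (inl b)))
  | PE b => Some (inl (inr (inr b)))
  | PM i j => Some (inr (i, j))
  end.
Definition point_decode c : point m :=
  match c with
  | None => PU
  | Some (inl (inl i)) => PH i
  | Some (inl (inr (inl b))) => PG b
  | Some (inl (inr (inr b))) => PE b
  | Some (inr (i, j)) => PM i j
  end.
Lemma point_codeK : cancel point_code point_decode. Proof. by case. Qed.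

Definition terminal_code (t : terminal m) :
    option (option ('I_m.+1 + 'I_m.+1 + bool + (bool * bool + bool * bool))) :=
  match t with
  | TZ => None
  | TK => Some None
  | TX i => Some (Some (inl (inl (inl i))))
  | TH i => Some (Some (inl (inl (inr i))))
  | TG b => Some (Some (inl (inr b)))
  | TL i j => Some (Some (inr (inl (i, j))))
  | TR i j => Some (Some (inr (inr (i, j))))
  end.
Definition terminal_decode c : terminal m :=
  match c with
  | None => TZ
  | Some None => TK
  | Some (Some (inl (inl (inl i)))) => TX i
  | Some (Some (inl (inl (inr i)))) => TH i
  | Some (Some (inl (inr b))) => TG b
  | Some (Some (inr (inl (i, j)))) => TL i j
  | Some (Some (inr (inr (i, j)))) => TR i j
  end.
Lemma terminal_codeK : cancel terminal_code terminal_decode. Proof. by case. Qed.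

End Encoding.

HB.instance Definition _ m := Finite.copy (source m) (can_type (@source_codeK m)).
HB.instance Definition _ m := Finite.copy (point m) (can_type (@point_codeK m)).
HB.instance Definition _ m := Finite.copy (terminal m) (can_type (@terminal_codeK m)).

Section GapCircuit.
Variables (m : nat) (k : bool -> nat).

Definition gap_psrc (p : point m) (s : source m) : bool :=
  match p, s with
  | PU, (SY | SZ | SX _) => true
  | PH _, SZ => true
  | PH i, SX j => j == i
  | PE false, (SA | SZ) => true
  | PE true, SR _ => true
  | PM _ _, (SA | SZ | SR _) => true
  | _, _ => false
  end.

Definition gap_ppnt (p : point m) : seq (point m) :=
  if p is PG b then [seq PH i | i : 'I_m.+1 <- enum 'I_m.+1 & (i < k b)%N] else [::].

Definition gap_tsrc (t : terminal m) (s : source m) : bool :=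
  match t, s with
  | TX _, (SY | SZ) => true
  | TX i, SX j => j != i
  | TZ, (SY | SX _) => true
  | TH i, SX j => j != i
  | TG _, SZ => true
  | TG b, SX j => (k b <= j)%N
  | TK, SX j => j != ord0
  | TL true true, SX j => j != ord0
  | _, _ => false
  end.

Definition gap_tpnt (t : terminal m) : seq (point m) :=
  match t with
  | TX _ | TZ => [:: PU]
  | TH i => [:: PU; PH i]
  | TG b => [:: PU; PG b]
  | TK => [:: PG true]
  | TL i j => [:: PE false, PE true, PM i j & if i && j then [:: PG false] else [::]]
  | TR i j => [:: PE false; PE true; PM i j]
  end.

Definition gap_goal (t : terminal m) : source m :=
  match t with
  | TX i => SX i
  | TZ => SZ
  | TH _ | TG _ => SY
  | TK => SX ord0
  | TL i j => if i then (if j then SX ord0 else SZ) else SA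
  | TR _ j => SR j
  end.

Definition gap_lvl (p : point m) : nat := if p is PG _ then 1 else 0.

Lemma gap_ppnt_uniq p : uniq (gap_ppnt p).
Proof.
case: p => //= b; rewrite map_inj_uniq => [|i j [] //].
exact/filter_uniq/enum_uniq.
Qed.

Lemma gap_tpnt_uniq t : uniq (gap_tpnt t).
Proof. by case: t => // -[] []. Qed.

Lemma gap_ppnt_lvl p q : q \in gap_ppnt p -> (gap_lvl q < gap_lvl p)%N.
Proof. by case: p => // b /mapP[i _ ->]. Qed.

Definition gap_circuit : circuit :=
  Circuit gap_psrc gap_tsrc gap_goal gap_ppnt_uniq gap_tpnt_uniq gap_ppnt_lvl.

Lemma sum_ppnt_PG (V : nmodType) (f : point m -> V) b :
  \sum_(q <- gap_ppnt (PG b)) f q = \sum_(i < m.+1 | (i < k b)%N) f (PH i).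
Proof. by rewrite /= big_map big_filter big_enum_cond. Qed.

Hypothesis k_bounds : forall b, (0 < k b <= m.+1)%N.

(** * Necessity: what decoding forces on the characteristic *)

Section Necessity.

Variables (F : fieldType) (d : nat) (M : point m -> source m -> 'M[F]_d).
Hypothesis M_transfer : transfer_matrices (C := gap_circuit) M.

Lemma M_points p : exists A : point m -> 'M[F]_d, forall s,
  ~~ gap_psrc p s -> M p s = \sum_(q <- gap_ppnt p) A q *m M q s.
Proof. exact: M_transfer.1. Qed.

Lemma M_terminals t : exists B : point m -> 'M[F]_d, forall s,
  ~~ gap_tsrc t s ->
  \sum_(q <- gap_tpnt t) B q *m M q s = if s == gap_goal t then 1%:M else 0.
Proof. exact: M_transfer.2. Qed.

Lemma M_eq0 p s : gap_ppnt p = [::] -> ~~ gap_psrc p s -> M p s = 0.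
Proof.
by move=> p0; have [A AE] := M_points p => /AE ->; rewrite p0 big_nil.
Qed.

(** Each of these terminals sees [PU] alone besides sources, and not the source it demands, so its
    weight at [PU] inverts the coefficient. *)
Lemma M_U_unit : M PU SZ \in unitmx /\ forall i, M PU (SX i) \in unitmx.
Proof.
split=> [|i].
  have [B /(_ SZ isT)] := M_terminals TZ.
  by rewrite big_seq1 eqxx => /mulmx1_unit[].
have [B /(_ (SX i))] := M_terminals (TX i).
by rewrite /= !eqxx big_seq1 => /(_ isT)/mulmx1_unit[].
Qed.

(* The terminal [TH i] forces [PH i] to carry a multiple of the restriction of
   [PU] to [SZ] and [SX i]; then [TG b] forces all the points [PH i] to enter
   [PG b] with the same weight. *)
Lemma M_PG b : exists2 Q, Q \in unitmx & M (PG b) SZ = Q *+ k b.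
Proof.
have [UZ UX] := M_U_unit.
have [A AE] := M_points (PG b).
have {}AE s : M (PG b) s = \sum_(i < m.+1 | (i < k b)%N) A (PH i) *m M (PH i) s.
  by rewrite -(sum_ppnt_PG (fun p => A p *m M p s)); apply: AE.
have [B BE] := M_terminals (TG b).
(* No [PH i] receives y, so [TG b] and [TH i] can obtain y only through [PU]. *)
have GY : M (PG b) SY = 0.
  by rewrite AE big1 // => i _; rewrite (@M_eq0 (PH i)) ?mulmx0.
have := BE SY isT; rewrite !big_cons big_nil GY mulmx0 !addr0 eqxx => RY.
have [Ru _] := mulmx1_unit RY.
have [c cE] : exists c : 'I_m.+1 -> 'M[F]_d, forall i,
    c i *m M (PH i) SZ = - (B PU *m M PU SZ) /\
    c i *m M (PH i) (SX i) = - (B PU *m M PU (SX i)).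
  apply: (@fin_all_exists _ _ (fun i c =>
    c *m M (PH i) SZ = - (B PU *m M PU SZ) /\
    c *m M (PH i) (SX i) = - (B PU *m M PU (SX i)))) => i.
  have [B' B'E] := M_terminals (TH i); exists (B' (PH i)).
  have := B'E SY isT.
  rewrite !big_cons big_nil (@M_eq0 (PH i)) // mulmx0 !addr0 eqxx => R'Y.
  (* Both weights are the inverse of [M PU SY]. *)
  have -> : B PU = B' PU.
    have [_ Yu] := mulmx1_unit RY.
    by rewrite -[LHS](mulmxK Yu) RY -R'Y mulmxK.
  have := B'E SZ isT; have := B'E (SX i); rewrite /= eqxx => /(_ isT).
  rewrite !big_cons !big_nil !addr0 => /eqP + /eqP.
  by rewrite !addr_eq0 => /eqP -> /eqP ->; rewrite !opprK.
have cu i : (c i \in unitmx) && (M (PH i) (SX i) \in unitmx).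
  by rewrite -unitmx_mul (cE i).2 -mulNmx unitmx_mul UX andbT -scaleN1r unitmxZ ?unitrN1.
have CE (i : 'I_m.+1) : (i < k b)%N -> B (PG b) *m A (PH i) = c i.
  move=> ik; have /andP[_ Hu] := cu i.
  have := BE (SX i); rewrite /= -ltnNge => /(_ ik).
  rewrite !big_cons big_nil !addr0 => /eqP; rewrite addr_eq0 => /eqP.
  rewrite AE (bigD1 i) //= big1 ?addr0 => [eqi|j /andP[_ ji]]; last first.
    by rewrite (@M_eq0 (PH j)) ?mulmx0 //= eq_sym.
  by apply: (can_inj (mulmxK Hu)); rewrite (cE i).2 -mulmxA eqi opprK.
have Cu : B (PG b) \in unitmx.
  have /andP[k0 _] := k_bounds b.
  have := cu ord0; rewrite -(CE ord0 k0) => /andP[+ _].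
  by rewrite unitmx_mul => /andP[].
(* Times [B (PG b)], every [PH i] entering [PG b] contributes the same z coefficient, opposite to
   that of [B PU *m M PU SZ]; there are [k b] of them. *)
exists (- (invmx (B (PG b)) *m (B PU *m M PU SZ))).
  by rewrite -scaleN1r unitmxZ ?unitrN1 // !unitmx_mul unitmx_inv Cu Ru.
rewrite AE -mulmxN; under eq_bigr => i ik.
  rewrite -(mulKmx Cu (A _)) CE // -mulmxA (cE i).1; over.
have /andP[_ km] := k_bounds b.
by rewrite -(big_ord_widen _ (fun _ => _) km) sumr_const card_ord.
Qed.

(** [TK] sees no point but [PG true] and demands x_0, so its weight there is invertible; as z must
    disappear, an invertible matrix times [k true] is 0. Positive dimension makes that matrix
    nonzero. *)
Lemma k_true_eq0 : (0 < d)%N -> (k true)%:R = 0 :> F.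
Proof.
move=> d0; have [Q Qu QE] := M_PG true.
have [B BE] := M_terminals TK.
have := BE (SX ord0) isT; rewrite big_seq1 eqxx => /mulmx1_unit[Bu _].
have := BE SZ isT; rewrite big_seq1 QE -scaler_nat -scalemxAr /= => /eqP.
rewrite scaler_eq0 => /orP[/eqP//|/eqP BQ0].
have : B (PG true) *m Q \in unitmx by rewrite unitmx_mul Bu.
move=> /mulmxV; rewrite BQ0 mul0mx => /matrixP/(_ (Ordinal d0) (Ordinal d0)).
by rewrite !mxE eqxx => /esym/eqP; rewrite oner_eq0.
Qed.

End Necessity.

(* [l], [r] are the coefficients of e_0, e_1, and [u], [v] those of the free
   edge, at one terminal of the M-network in dimension 1. *)
Lemma cross_bottleneck (F : fieldType) (l r u v : bool -> F) (i j : bool)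
    (lam b c e b' c' e' : F) : lam != 0 ->
  (forall i', b * l i' + e * u i' = if i' == i then lam else 0) ->
  (forall j', c * r j' + e * v j' = 0) ->
  (forall i', b' * l i' + e' * u i' = 0) ->
  (forall j', c' * r j' + e' * v j' = if j' == j then 1 else 0) ->
  [/\ l (~~ i) = 0 \/ r (~~ j) = 0, r j = 0 -> l (~~ i) = 0,
      l i = 0 -> r (~~ j) = 0 & ~ (l i = 0 /\ r j = 0)].
Proof.
move=> lam0 L R L' R'.
have ni : (~~ i == i) = false by case: (i).
have nj : (~~ j == j) = false by case: (j).
(* Eliminates the free edge between the left and the right terminal, leaving a determinant times a
   coefficient of e_0 or e_1. *)
have comb x y x' y' (f g : bool -> F) w : (x' * y - x * y') * f w =
    x' * (y * f w + x * g w) - x * (y' * f w + x' * g w) by ring.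
have Li : (e' * b - e * b') * l i = e' * lam.
  by rewrite (comb _ _ _ _ l u) L L' eqxx mulr0 subr0.
have Lni : (e' * b - e * b') * l (~~ i) = 0.
  by rewrite (comb _ _ _ _ l u) L L' ni !mulr0 subr0.
have Rj : (e' * c - e * c') * r j = - e.
  by rewrite (comb _ _ _ _ r v) R R' eqxx mulr0 mulr1 sub0r.
have Rnj : (e' * c - e * c') * r (~~ j) = 0.
  by rewrite (comb _ _ _ _ r v) R R' nj !mulr0 subr0.
(* Either condition prevents the right terminal from using the free edge: a nonzero unwanted
   coefficient on e_0 makes the determinant vanish. [e0] is the mirror statement for the left
   terminal. *)
have e'0 : l (~~ i) != 0 \/ l i = 0 -> e' = 0.
  case=> [l0|l0]; last first.
    by move/eqP: Li; rewrite l0 mulr0 eq_sym mulf_eq0 (negPf lam0) orbF => /eqP.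
  move/eqP: Lni; rewrite mulf_eq0 (negPf l0) orbF => /eqP Lni.
  by move/eqP: Li; rewrite Lni mul0r eq_sym mulf_eq0 (negPf lam0) orbF => /eqP.
have e0 : r (~~ j) != 0 \/ r j = 0 -> e = 0.
  case=> [r0|r0]; last by apply/eqP; rewrite -oppr_eq0 -Rj r0 mulr0.
  move/eqP: Rnj; rewrite mulf_eq0 (negPf r0) orbF => /eqP Rnj.
  by apply/eqP; rewrite -oppr_eq0 -Rj Rnj mul0r.
(* Without the free edge, the left terminal must read its message from e_0 alone. *)
have l0 : e = 0 -> l i != 0 /\ l (~~ i) = 0.
  move=> ee; have := L i; have := L (~~ i); rewrite eqxx ni ee !mul0r !addr0.
  move=> /eqP bl bli; have : b * l i != 0 by rewrite bli.
  rewrite mulf_eq0 negb_or => /andP[/negPf b0 ->].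
  by move: bl; rewrite mulf_eq0 b0 => /eqP.
have r0 : e' = 0 -> r j != 0 /\ r (~~ j) = 0.
  move=> ee; have := R' j; have := R' (~~ j); rewrite eqxx nj ee !mul0r !addr0.
  move=> /eqP bl bli; have : c' * r j != 0 by rewrite bli oner_eq0.
  rewrite mulf_eq0 negb_or => /andP[/negPf b0 ->].
  by move: bl; rewrite mulf_eq0 b0 => /eqP.
split.
- have [->|/(fun h => or_introl h)/e'0/r0[_ ->]] := eqVneq (l (~~ i)) 0; first by left.
  by right.
- by move=> rj; have [] := l0 (e0 (or_intror rj)).
- by move=> li; have [] := r0 (e'0 (or_intror li)).
- by case=> li rj; have [] := l0 (e0 (or_intror rj)); rewrite li eqxx.
Qed.

(** If [k false] were nonzero, [TL true true] would have to cancel a nonzero multiple of z carried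
    by [PG false], hence extract z from the M-network; [cross_bottleneck] would then hold at all
    four pairs, which is contradictory. *)
Lemma k_false_eq0 (F : fieldType) (M : point m -> source m -> 'M[F]_1) :
  transfer_matrices (C := gap_circuit) M -> (k false)%:R = 0 :> F.
Proof.
move=> ok; have Mp := M_points ok; have Mt := M_terminals ok.
apply/eqP; apply: contraT => k0.
have M0 := M_eq0 ok.
pose ls (i : bool) : source m := if i then SZ else SA.
pose l i := M (PE false) (ls i) 0 0.
pose r j := M (PE true) (SR j) 0 0.
have entry (A B : 'M[F]_1) : (A *m B) 0 0 = A 0 0 * B 0 0 by rewrite mxE big_ord1.
pose u i j i' := M (PM i j) (ls i') 0 0.
pose v i j j' := M (PM i j) (SR j') 0 0.
have lsA i' : gap_psrc (PE false) (ls i') by case: i'.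
have nlsE i' : ~~ gap_psrc (PE true) (ls i') by case: i'.
have right_demand i j : exists b c e,
    (forall i', b * l i' + e * u i j i' = 0) /\
    (forall j', c * r j' + e * v i j j' = if j' == j then 1 else 0).
  have [B BE] := Mt (TR i j).
  exists (B (PE false) 0 0), (B (PE true) 0 0), (B (PM i j) 0 0); split=> [i'|j'].
    have := BE (ls i'); rewrite !big_cons big_nil (M0 (PE true)) // mulmx0 add0r addr0.
    move=> /(_ (match i' with true => isT | false => isT end)).
    move=> /matrixP/(_ 0 0); rewrite mxE !entry => ->.
    by case: i'; rewrite /= mxE.
  have := BE (SR j') isT; rewrite !big_cons big_nil (M0 (PE false)) //.
  rewrite mulmx0 add0r addr0 => /matrixP/(_ 0 0); rewrite mxE !entry => ->.
  by rewrite -[SR j' == _]/(j' == j); case: ifP; rewrite mxE.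
have G0 s : (if s is (SA | SR _) then true else false) -> M (PG false) s = 0.
  have [A AE] := Mp (PG false) => sAR.
  rewrite AE ?sum_ppnt_PG ?big1 // => i _.
  by rewrite (M0 (PH i)) ?mulmx0 //; case: s sAR.
(* [lam] is 1 except at (1, 1), where it is minus the z coefficient arriving from [PG false]. *)
have left_demand i j : exists lam b c e, [/\ lam != 0,
    (forall i', b * l i' + e * u i j i' = if i' == i then lam else 0) &
    (forall j', c * r j' + e * v i j j' = 0)].
  have [B BE] := Mt (TL i j).
  have Gx : i && j ->
      [/\ (B (PG false) *m M (PG false) SZ) 0 0 != 0,
         forall i', B (PE false) *m M (PE false) (ls i') + B (PM i j) *m M (PM i j) (ls i')
           = if i' == i then - (B (PG false) *m M (PG false) SZ) else 0 &
         forall j', B (PE true) *m M (PE true) (SR j') + B (PM i j) *m M (PM i j) (SR j') = 0].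
    case: i BE => //; case: j => // BE _; split=> [|i'|j'].
    - have [Q Qu ->] := M_PG ok false.
      have := BE (SX ord0) isT; rewrite !big_cons big_nil
        (M0 (PE false)) // (M0 (PE true)) // (M0 (PM _ _)) //.
      rewrite !mulmx0 !add0r addr0 eqxx => /matrixP/(_ 0 0) GX.
      have B1 : B (PG false) 0 0 * M (PG false) (SX ord0) 0 0 = 1.
        by rewrite -entry GX mxE.
      rewrite -scaler_nat entry mxE !mulf_neq0 //.
        by apply/eqP => B0; move/eqP: B1; rewrite B0 mul0r eq_sym oner_eq0.
      by move: Qu; rewrite unitmxE det_mx11 unitfE.
    - have := BE (ls i') (match i' with true => isT | false => isT end).
      rewrite !big_cons big_nil (M0 (PE true)) // mulmx0 add0r addr0 addrA.
      case: i' => /= /eqP; first by rewrite addr_eq0 => /eqP.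
      by rewrite (G0 SA) // mulmx0 addr0 => /eqP.
    - have := BE (SR j') isT.
      by rewrite !big_cons big_nil (M0 (PE false)) // (G0 (SR j')) // !mulmx0 add0r !addr0.
  have [ij|nij] := boolP (i && j).
    have [lam0 L R] := Gx ij.
    exists (- (B (PG false) *m M (PG false) SZ) 0 0).
    exists (B (PE false) 0 0), (B (PE true) 0 0), (B (PM i j) 0 0).
    split=> [|i'|j']; first by rewrite oppr_eq0.
      have /matrixP/(_ 0 0) := L i'; rewrite mxE !entry => ->.
      by case: ifP; rewrite mxE // entry.
    by have /matrixP/(_ 0 0) := R j'; rewrite mxE !entry mxE.
  exists 1, (B (PE false) 0 0), (B (PE true) 0 0), (B (PM i j) 0 0).
  split=> [|i'|j']; first exact: oner_neq0.
    have : ~~ gap_tsrc (TL i j) (ls i') by case: (i) nij; case: (j); case: (i').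
    move=> /BE; rewrite !big_cons (negPf nij) big_nil (M0 (PE true)) // mulmx0 add0r addr0.
    move=> /matrixP/(_ 0 0); rewrite mxE !entry => ->.
    by case: (i) nij; case: (j) => // _; case: (i'); rewrite /= mxE.
  have : ~~ gap_tsrc (TL i j) (SR j') by case: (i) nij; case: (j).
  move=> /BE; rewrite !big_cons (negPf nij) big_nil (M0 (PE false)) // mulmx0 add0r addr0.
  move=> /matrixP/(_ 0 0); rewrite mxE !entry => ->.
  by case: (i) nij; case: (j) => // _; rewrite /= mxE.
have cross i j : [/\ l (~~ i) = 0 \/ r (~~ j) = 0, r j = 0 -> l (~~ i) = 0,
      l i = 0 -> r (~~ j) = 0 & ~ (l i = 0 /\ r j = 0)].
  have [lam [b [c [e [lam0 L R]]]]] := left_demand i j.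
  have [b' [c' [e' [L' R']]]] := right_demand i j.
  exact: cross_bottleneck lam0 L R L' R'.
have [_ rl lr _] := cross false false; have [_ _ _ nlr] := cross false true.
have [lr' _ _ nlr'] := cross true false; have [lr'' _ _ _] := cross true true.
(* As [l false] is nonzero, the pairs (1, 0) and (1, 1) force both [r true] and [r false] to vanish;
   (0, 0) then gives [l true = 0], which (1, 0) forbids. *)
have lf : l false <> 0 by move=> l0; apply: nlr; split=> //; exact: lr.
have rt : r true = 0 by case: lr'.
have rf : r false = 0 by case: lr''.
by case: nlr'; split=> //; exact: rl.
Qed.

(* At (1, 1) only [(k false) z] has to be cancelled from [PG false], not [z]. *)
Lemma gap_circuit_solvable (F : fieldType) d (l r : bool -> 'M[F]_d)
    (u v : bool -> bool -> bool -> 'M[F]_d) :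
  (k true)%:R = 0 :> F ->
  (forall i j, exists b c e,
     (forall i', b *m l i' + e *m u i j i' =
        if i' == i then (if i && j then - (k false)%:R%:M else 1%:M) else 0) /\
     (forall j', c *m r j' + e *m v i j j' = 0)) ->
  (forall i j, exists b c e,
     (forall i', b *m l i' + e *m u i j i' = 0) /\
     (forall j', c *m r j' + e *m v i j j' = if j' == j then 1%:M else 0)) ->
  circuit_solution gap_circuit d F.
Proof.
move=> k0 left_dec right_dec.
pose M (p : point m) (s : source m) : 'M[F]_d :=
  match p, s with
  | PU, (SY | SZ | SX _) => 1%:M
  | PH _, SZ => 1%:M
  | PH i, SX j => if j == i then 1%:M else 0
  | PG b, SZ => (k b)%:R%:M
  | PG b, SX j => if (j < k b)%N then 1%:M else 0
  | PE false, SA => l false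
  | PE false, SZ => l true
  | PE true, SR j => r j
  | PM i j, SA => u i j false
  | PM i j, SZ => u i j true
  | PM i j, SR j' => v i j j'
  | _, _ => 0
  end.
exists M; rewrite /=; split=> [p|t].
  exists (fun _ => 1%:M) => s; case: p => [|i|b|b|i j].
  - by case: s => [||j||j] //=; rewrite big_nil.
  - by case: s => [||j||j] //=; rewrite big_nil // => /negPf ->.
  - rewrite sum_ppnt_PG => _; under eq_bigr do rewrite mul1mx.
    case: s => [||j||j] /=; try by rewrite big1.
      have /andP[_ km] := k_bounds b.
      by rewrite -(big_ord_widen _ (fun _ => _) km) sumr_const card_ord raddfMn.
    rewrite -big_mkcondr /= big_mkcond (bigD1 j) //= eqxx andbT big1 ?addr0 // => i ij.
    by rewrite (eq_sym j) (negPf ij) andbF.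
  - by case: b; case: s => [||j||j] //=; rewrite big_nil.
  - by case: s => [||j'||j'] //=; rewrite big_nil.
(* For [TH] and [TG]: y is u minus h_i, or u minus g_k, up to sources seen directly. *)
have sgn : exists B : point m -> 'M[F]_d, B PU = 1%:M /\ forall p, p != PU -> B p = - 1%:M.
  by exists (fun p => if p == PU then 1%:M else - 1%:M); split=> // p /negPf ->.
have [B [BU Bp]] := sgn.
case: t => [i||i|b||i j|i j].
- exists (fun _ => 1%:M) => s; rewrite big_seq1 mul1mx.
  by case: s => //= j; rewrite negbK => /eqP ->; rewrite eqxx.
- by exists (fun _ => 1%:M) => s; rewrite big_seq1 mul1mx; case: s.
- exists B => s; rewrite !big_cons big_nil BU Bp // mulNmx !mul1mx addr0.
  by case: s => [||j||j] //=; rewrite ?subr0 ?subrr // negbK => ->; rewrite subrr.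
- exists B => s; rewrite !big_cons big_nil BU Bp // mulNmx !mul1mx addr0.
  by case: s => [||j||j] //=; rewrite ?subr0 ?subrr // -ltnNge => ->; rewrite subrr.
- exists (fun _ => 1%:M) => s; rewrite big_seq1 mul1mx.
  case: s => [||j||j] //=; first by rewrite k0 raddf0.
  rewrite negbK => /eqP ->; rewrite eqxx.
  by have /andP[-> _] := k_bounds true.
- have [b [c [e [L R]]]] := left_dec i j.
  (* At (1, 1), [PG false] enters with weight 1, and its z term cancels the multiple of z extracted
     from the M-network. *)
  exists (fun p => match p with PE false => b | PE true => c | PM _ _ => e | _ => 1%:M end) => s.
  rewrite !big_cons; case: s => [||i'||j'] /= ns; rewrite ?mulmx0 ?add0r.
  + by case: (i && j); rewrite ?big_seq1 ?big_nil ?mulmx0; case: (i); case: (j).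
  + rewrite addrA (L true); case: i {L R ns}; case: j => //=; rewrite ?big_nil ?addr0 ?add0r //.
    by rewrite big_seq1 mul1mx addNr.
  + case: i {L R} ns; case: j => //=; rewrite ?big_nil ?big_seq1 //.
    rewrite negbK => /eqP ->; rewrite eqxx mul1mx.
    by rewrite /=; have /andP[-> _] := k_bounds false.
  + rewrite addrA (L false); case: i {L R ns}; case: j => //=;
      by rewrite ?big_seq1 ?mulmx0 ?big_nil ?addr0.
  + rewrite addrA (R j') add0r.
    by case: i {L R ns}; case: j => //=; rewrite ?big_seq1 ?mulmx0 ?big_nil.
- have [b [c [e [L R]]]] := right_dec i j.
  exists (fun p => match p with PE false => b | PE true => c | _ => e end) => s.
  rewrite !big_cons big_nil addr0; case: s => [||i'||j'] /= ns; rewrite ?mulmx0 ?add0r //.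
Qed.

End GapCircuit.

(** * Explicit codes in dimensions 1 and 2 *)

Lemma circuit_solution_scalar m k (F : fieldType) :
  (forall b, (0 < k b <= m.+1)%N) ->
  (k false)%:R = 0 :> F -> (k true)%:R = 0 :> F ->
  circuit_solution (gap_circuit m k) 1 F.
Proof.
move=> kb k0 k1.
pose ind (b : bool) : 'M[F]_1 := if b then 1%:M else 0.
apply: (@gap_circuit_solvable m k kb F 1 (fun i => ind (~~ i)) (fun j => ind (~~ j))
  (fun i j i' => ind [&& i, ~~ j & i']) (fun i j j' => ind (j && j'))) => // i j.
  exists (ind (~~ i)), 0, (ind (i && ~~ j)); rewrite k0 raddf0 oppr0 /ind.
  by split; case: i; case: j; case=> /=; rewrite ?mul1mx ?mul0mx ?mulmx0 ?addr0 ?add0r.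
exists 0, (ind (~~ j)), (ind j); rewrite /ind.
by split; case: i; case: j; case=> /=; rewrite ?mul1mx ?mul0mx ?mulmx0 ?addr0 ?add0r.
Qed.

Lemma circuit_solution_2 m k (F : fieldType) :
  (forall b, (0 < k b <= m.+1)%N) -> (k true)%:R = 0 :> F ->
  circuit_solution (gap_circuit m k) 2 F.
Proof.
move=> kb k1.
pose o (b : bool) : 'I_2 := if b then 1 else 0.
have oE b b' : (o b == o b') = (b == b') by case: b; case: b'.
pose D a b : 'M[F]_2 := delta_mx (o a) (o b).
have DD a b c e : D a b *m D c e = if b == c then D a e else 0.
  by rewrite mul_delta_mx_cond oE; case: eqP.
have D1 : D false false + D true true = 1%:M.
  by apply/matrixP=> -[[|[|i]] ?] [[|[|j]] ?]; rewrite !mxE //= ?addr0 ?add0r.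
(* e_0 and e_1 carry the first coordinates of their two messages; the free edge carries the second
   coordinates of the two messages demanded at (i, j). *)
apply: (@gap_circuit_solvable m k kb F 2 (fun i => D i false) (fun j => D j false)
  (fun i j i' => if i' == i then D false true else 0)
  (fun i j j' => if j' == j then D true true else 0)) => // i j.
  set c := if _ then _ else _.
  exists (c *m D false i), 0, (c *m D true false); split=> [i'|j'].
    rewrite -!mulmxA -mulmxDr DD eq_sym.
    by case: eqP => _; rewrite ?DD ?D1 ?mulmx1 // mulmx0 addr0 mulmx0.
  by rewrite mul0mx add0r -mulmxA; case: ifP => _; rewrite ?DD !mulmx0.
exists 0, (D false j), (D true true); split=> [i'|j'].
  by rewrite mul0mx add0r; case: ifP => _; rewrite ?DD ?mulmx0.
by rewrite DD eq_sym; case: eqP => _; rewrite ?DD ?mulmx0 ?addr0.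
Qed.

(** * Products of primes and the choice of parameters *)

Lemma natr_prod_primes_eq0 (F : fieldType) (P : seq nat) : all prime P ->
  ((\prod_(p <- P) p)%:R == 0 :> F) = has (fun p => p \in [pchar F]) P.
Proof.
elim: P => [_|p P IH /= /andP[pp /IH IHP]]; first by rewrite big_nil oner_eq0.
by rewrite big_cons natrM mulf_eq0 IHP inE pp.
Qed.

Lemma prod_primes_gt0 (P : seq nat) : all prime P -> (0 < \prod_(p <- P) p)%N.
Proof.
move/allP => pP; rewrite big_seq prodn_cond_gt0 // => p /pP; exact: prime_gt0.
Qed.

Theorem theorem2 (P1 P2 : seq nat) :
  P1 != [::] -> P2 != [::] -> all prime P1 -> all prime P2 ->
  exists N : network, P_eq N 1 P1 /\ P_eq N 2 (P1 ++ P2).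
Proof.
move=> _ _ pP1 pP2.
have pP12 : all prime (P1 ++ P2) by rewrite all_cat pP1.
(* [k false] divides [k true], so a scalar code needs only [k false] to vanish; taking [m] to be
   [k true] leaves enough x_i for both bottlenecks. *)
pose k (b : bool) := (\prod_(p <- if b then P1 ++ P2 else P1) p)%N.
have kb b : (0 < k b <= (k true).+1)%N.
  rewrite /k prod_primes_gt0; last by case: b.
  case: b => /=; first exact: leqnSn.
  by rewrite big_cat /= leqW // leq_pmulr // prod_primes_gt0.
exists (circuit_network (gap_circuit (k true) k)); split=> F;
  rewrite -natr_prod_primes_eq0 //.
  apply: (iff_trans (circuit_networkP _ _ _)); split=> [[M ok]|/eqP k0].
    exact/eqP/(k_false_eq0 kb ok).
  apply: circuit_solution_scalar => //.
  by rewrite /k big_cat /= natrM k0 mul0r.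
apply: (iff_trans (circuit_networkP _ _ _)); split=> [[M ok]|/eqP k0].
  exact/eqP/(k_true_eq0 kb ok).
exact: circuit_solution_2.
Qed.
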